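(* Let $\eta$ be a dual certificate of the primal problem $$\min_{m\in\mathcal{M}(\mathbb{T}),\ \tilde{\boldsymbol{\Phi}}(m)=\mathbf{y}_0}\|m\|_{TV},$$ with a finite set of saturation points $\mathrm{Sat}(\eta)=\{\tau_1,\dots,\tau_P\}$ ($\tau_p$ pairwise distinct). If the linear map $$\mathbb{R}^P\to\mathbb{R}^L,\qquad \boldsymbol{\beta}\mapsto\tilde{\boldsymbol{\Phi}}\Big(\sum_{p=1}^P\beta_p\,\text{Ш}(\cdot-\tau_p)\Big)=\Big(\sum_{p=1}^P\beta_p\,\psi_{\mathcal{D}}(\theta_\ell-\tau_p)\Big)_{\ell=1,\dots,L}$$ is injective, then the solution of the primal problem is unique. In terms of matrices, this injectivity is equivalent to the matrix $\Psi_{\boldsymbol{\tau}}=\big(\psi_{\mathcal{D}}(\theta_\ell-\tau_p)\big)_{1\le\ell\le L,\,1\le p\le P}\in\mathbb{R}^{L\times P}$ having full column rank (rank $P$).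
   Context: Let $T>0$ and $\mathbb{T}=\mathbb{R}/T\mathbb{Z}$. $\mathcal{C}(\mathbb{T})$ is the space of real continuous $T$-periodic functions with the sup norm $\|\cdot\|_\infty$; $\mathcal{M}(\mathbb{T})$ is the space of finite real periodic Radon measures (the dual of $\mathcal{C}(\mathbb{T})$), with total variation norm $\|m\|_{TV}=\sup\{\langle m,\varphi\rangle:\varphi\in\mathcal{C}(\mathbb{T}),\|\varphi\|_\infty\le 1\}$, $\langle m,\varphi\rangle=\int_{\mathbb{T}}\varphi\,\mathrm{d}m$. $\text{Ш}=\sum_{i\in\mathbb{Z}}\delta(\cdot-iT)$ is the $T$-periodic Dirac comb, so $\text{Ш}(\cdot-\tau)$ is the periodic Dirac impulse at $\tau\in\mathbb{T}$. $\mathcal{D}$ is an invertible linear, continuous, shift-invariant operator on the space $\mathcal{S}'(\mathbb{T})$ of periodic generalized functions, whose Green's function $\psi_{\mathcal{D}}=\mathcal{D}^{-1}\{\text{Ш}\}$ is a continuous real-valued $T$-periodic function (sampling-admissibility). Given sampling points $\theta_1,\dots,\theta_L\in\mathbb{T}$, the measurement operator is $\tilde{\boldsymbol{\Phi}}:\mathcal{M}(\mathbb{T})\to\mathbb{R}^L$, $\tilde{\boldsymbol{\Phi}}(m)=\big(\int_{\mathbb{T}}\psi_{\mathcal{D}}(\theta_\ell-t)\,\mathrm{d}m(t)\big)_{\ell=1,\dots,L}$, with adjoint $\tilde{\boldsymbol{\Phi}}^*:\mathbb{R}^L\to\mathcal{C}(\mathbb{T})$, $\tilde{\boldsymbol{\Phi}}^*\mathbf{h}=\sum_{\ell=1}^L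 h_\ell\,\psi_{\mathcal{D}}(\theta_\ell-\cdot)$. The data are $\mathbf{y}_0=\tilde{\boldsymbol{\Phi}}(m_0)$ for some $m_0\in\mathcal{M}(\mathbb{T})$. A function $\eta\in\mathcal{C}(\mathbb{T})$ is a dual certificate of the primal problem if: (i) $\eta$ belongs to the range of $\tilde{\boldsymbol{\Phi}}^*$; (ii) $\|\eta\|_\infty\le1$; (iii) for any solution $m^\star$ of the primal problem, $\langle m^\star,\eta\rangle=\|m^\star\|_{TV}$. Its set of saturation points is $\mathrm{Sat}(\eta)=\{t\in\mathbb{T}:\eta(t)=\pm1\}$. *)

(* Defs.v *)
From HB Require Import structures.
From mathcomp Require Import all_boot all_order all_algebra.
From mathcomp Require Import generic_quotient ring_quotient.
From mathcomp Require Import all_classical all_reals all_analysis.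

Set Implicit Arguments.
Unset Strict Implicit.
Unset Printing Implicit Defensive.

Import Order.TTheory GRing.Theory Num.Theory.
Import numFieldNormedType.Exports.

Local Open Scope classical_set_scope.
Local Open Scope ring_scope.

Section circle.
Context {R : realType}.

Definition periods (T : R) : {pred R} := [pred x | `[< exists k : int, x = T *~ k >]].

Lemma periods_zmod_closed (T : R) : zmod_closed (periods T).
Proof.
split; first by apply/asboolP; exists 0; rewrite mulr0z.
move=> x y /asboolP[k ->] /asboolP[l ->].
by apply/asboolP; exists (k - l); rewrite mulrzBr.
Qed.

HB.instance Definition _ (T : R) :=
  GRing.isZmodClosed.Build R (periods T) (periods_zmod_closed T).

(* R/TZ, as the quotient additive group with the quotient topology and the
   Borel sigma-algebra of that topology; T-periodic functions on R are functions
   on [circle T]. *)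
Definition circle (T : R) : Type :=
  quotient_topology (Quotient.quot (periods T)).

HB.instance Definition _ (T : R) := PointedTopological.on (circle T).
HB.instance Definition _ (T : R) :=
  GRing.Zmodule.copy (circle T) (Quotient.quot (periods T)).
HB.instance Definition _ (T : R) :=
  Measurable.copy (circle T) (g_sigma_algebraType (@open (circle T))).

Definition to_circle (T : R) (x : R) : circle T := (\pi_(circle T) x)%qT.

End circle.

Section test_functions.
Context {R : realType}.
Implicit Type T : R.

(* Infinite differentiability, read on the T-periodic lift to R. *)
Definition smooth T : {pred circle T -> R} :=
  [pred f | `[< forall n x, derivable (derive1n n (f \o to_circle T)) x 1 >]].
Arguments smooth T : clear implicits.

Lemma derive1n_lin T (a : R) (f g : circle T -> R) n :
  f \in smooth T -> g \in smooth T ->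
  derive1n n ((a *: f + g) \o to_circle T) =
  a *: derive1n n (f \o to_circle T) + derive1n n (g \o to_circle T).
Proof.
move=> /asboolP df /asboolP dg; elim: n => [//|n IHn].
rewrite !derive1nS IHn; apply/funext => x.
rewrite derive1E deriveD; [|exact: derivableZ|exact: dg].
by rewrite deriveZ // -!derive1E.
Qed.

Lemma smooth_submod_closed T : submod_closed (smooth T).
Proof.
have smooth0 : (0 : circle T -> R) \in smooth T.
  apply/asboolP => n x.
  suff -> : derive1n n ((0 : circle T -> R) \o to_circle T) = cst 0.
    exact: derivable_cst.
  elim: n => [//|n IHn]; rewrite derive1nS IHn; apply/funext => y.
  by rewrite derive1_cst.
split => // a f g sf sg; apply/asboolP => n x.
rewrite derive1n_lin //.
by apply: derivableD; [apply: derivableZ|]; move: x;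
  [move/asboolP: sf|move/asboolP: sg]; exact.
Qed.

HB.instance Definition _ T :=
  GRing.isSubmodClosed.Build R (circle T -> R) (smooth T)
    (smooth_submod_closed T).

Record testfun T := TestFun
  { testfun_val :> circle T -> R; testfun_smooth : testfun_val \in smooth T }.

HB.instance Definition _ T := [isSub for @testfun_val T].
HB.instance Definition _ T := [Choice of testfun T by <:].
HB.instance Definition _ T := [SubChoice_isSubLmodule of testfun T by <:].

Definition derivatives T (phi : testfun T) :
    prod_topology (fun _ : nat => {uniform R -> R}) :=
  fun n => derive1n n (phi \o to_circle T).

(* The Frechet topology of C^oo(circle): uniform convergence of all the
   derivatives. *)
HB.instance Definition _ T :=
  Topological.copy (testfun T) (initial_topology (@derivatives T)).

End test_functions.
Arguments smooth {R} T.

Section distributions.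
Context {R : realType}.
Implicit Type T : R.

(* Periodic generalized functions: the topological dual of [testfun T]. *)
Definition distribution T : {pred testfun T -> R} :=
  [pred u : testfun T -> R | `[< linear u /\ continuous u >]].
Arguments distribution T : clear implicits.

Lemma continuous_lin (X : topologicalType) (a : R) (u v : X -> R) :
  continuous u -> continuous v -> continuous (fun x => a * u x + v x).
Proof.
by move=> cu cv x; apply: cvgD (cv x); apply: cvgM (cu x); exact: cvg_cst.
Qed.

Lemma distribution_submod_closed T : submod_closed (distribution T).
Proof.
split=> [|a u v /asboolP[lu cu] /asboolP[lv cv]]; apply/asboolP; split.
- by move=> a x y; rewrite /= scaler0 addr0.
- by move=> x; exact: cst_continuous.
- move=> b x y; rewrite -[LHS]/(a * u (b *: x + y) + v (b *: x + y)).
  rewrite lu lv -[RHS]/(b * (a * u x + v x) + (a * u y + v y)).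
  rewrite -![_ *: (_ : R)]/(_ * _).
  by rewrite !mulrDr addrACA mulrCA.
- exact: continuous_lin cu cv.
Qed.

HB.instance Definition _ T :=
  GRing.isSubmodClosed.Build R (testfun T -> R) (distribution T)
    (distribution_submod_closed T).

Record distr T := Distr
  { distr_val :> testfun T -> R; distr_subproof : distr_val \in distribution T }.

HB.instance Definition _ T := [isSub for @distr_val T].
HB.instance Definition _ T := [Choice of distr T by <:].
HB.instance Definition _ T := [SubChoice_isSubLmodule of distr T by <:].

(* Weak-* topology. *)
HB.instance Definition _ T :=
  Topological.copy (distr T)
    (initial_topology (@distr_val T : distr T -> {ptws testfun T -> R})).

Lemma testfun_continuousP T (X : topologicalType) (f : X -> testfun T) :
  (forall n, continuous (fun x => derivatives (f x) n : {uniform R -> R})) ->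
  continuous f.
Proof.
move=> fc; apply/continuousP => _ [B oB <-]; rewrite -comp_preimage.
suff: continuous (@derivatives R T \o f) by move/continuousP; exact.
move=> x; apply/cvg_sup => n; move: x.
apply/(@continuousP _ (initial_topology (@^~ n))) => _ [C oC <-].
by move/continuousP: (fc n) => /(_ _ oC).
Qed.

Lemma derivatives_continuous T n :
  continuous (fun phi : testfun T => derivatives phi n : {uniform R -> R}).
Proof.
move=> phi; apply: (@continuous_comp _ _ _ (@derivatives R T) (@proj nat _ n)).
  exact: initial_continuous.
exact: proj_continuous.
Qed.

Lemma derive1n_shift (g : R -> R) (c : R) n :
  derive1n n (fun x => g (x + c)) = fun x => derive1n n g (x + c).
Proof.
elim: n => [//|n IHn]; rewrite !derive1nS IHn; apply/funext => x.
rewrite !derive1E /derive /=.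
by under eq_fun do rewrite -addrA.
Qed.

Lemma to_circle0 T : to_circle T 0 = 0.
Proof. exact: (raddf0 (\pi_(Quotient.quot (periods T)))%qT). Qed.

Lemma to_circleD T x y : to_circle T (x + y) = to_circle T x + to_circle T y.
Proof. exact: (raddfD (\pi_(Quotient.quot (periods T)))%qT). Qed.

Lemma lift_shift T (phi : circle T -> R) (tau : circle T) :
  (fun t => phi (t + tau)) \o to_circle T =
  fun x => (phi \o to_circle T) (x + repr tau).
Proof.
by apply/funext => x; rewrite /= to_circleD; congr (phi (_ + _)); rewrite /to_circle reprK.
Qed.

Lemma smooth_shift T (phi : testfun T) (tau : circle T) :
  (fun t => phi (t + tau)) \in smooth T.
Proof.
apply/asboolP => n x; rewrite lift_shift derive1n_shift.
have /asboolP/(_ n (x + repr tau)) := testfun_smooth phi.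
rewrite /derivable /= => dphi.
by under eq_fun do rewrite -addrA.
Qed.

Definition shift_testfun T (tau : circle T) (phi : testfun T) : testfun T :=
  TestFun (smooth_shift phi tau).

Lemma shift_testfun_continuous T (tau : circle T) :
  continuous (shift_testfun tau).
Proof.
apply: testfun_continuousP => n phi P /uniform_nbhs[E [entE EP]].
have : nbhs (derivatives phi n : {uniform R -> R})
    [set h | forall y, E (derivatives phi n y, h y)].
  by apply/uniform_nbhs; exists E; split => // h hE y; exact: hE.
move=> /(@derivatives_continuous T n phi) nE.
apply: (@filterS _ (nbhs phi) (nbhs_filter phi) _ _ _ nE) => psi psiE.
apply: EP => y _.
by rewrite /derivatives !lift_shift !derive1n_shift; exact: psiE.
Qed.

Lemma distribution_translate T (tau : circle T) (u : distr T) :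
  (fun phi => u (shift_testfun tau phi)) \in distribution T.
Proof.
have /asboolP[lu cu] := distr_subproof u; apply/asboolP; split.
  move=> a phi psi; rewrite -lu; congr (u _); exact: val_inj.
move=> phi; apply: continuous_comp (cu _); exact: shift_testfun_continuous.
Qed.

(* u(. - tau), defined by <u(. - tau), phi> = <u, phi(. + tau)>. *)
Definition translate T (tau : circle T) (u : distr T) : distr T :=
  Distr (distribution_translate tau u).

Lemma distribution_comb T : (fun phi : testfun T => phi 0) \in distribution T.
Proof.
apply/asboolP; split=> // phi P /nbhsP[E entE EP].
have : nbhs (derivatives phi 0 : {uniform R -> R})
    [set h | forall y, E (derivatives phi 0 y, h y)].
  by apply/uniform_nbhs; exists E; split => // h hE y; exact: hE.
move=> /(@derivatives_continuous T 0 phi) nE.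
apply: (@filterS _ (nbhs phi) (nbhs_filter phi) _ _ _ nE) => psi psiE.
apply/EP/mem_set; have := psiE 0.
by rewrite /derivatives !derive1n0 /= to_circle0.
Qed.

(* sum_i delta(. - iT) restricted to one period: phi |-> phi 0. *)
Definition dirac_comb T : distr T := Distr (distribution_comb T).

Definition LSI T (D : distr T -> distr T) : Prop :=
  [/\ linear D, continuous D
    & forall tau u, D (translate tau u) = translate tau (D u)].

(* The generalized function u is the (say, continuous) periodic function f. *)
Definition represents T (f : circle T -> R) (u : distr T) : Prop :=
  forall phi : testfun T,
    u phi = \int[lebesgue_measure]_(x in `[0, T])
              (f (to_circle T x) * phi (to_circle T x)).

(* psi = D^-1 {dirac_comb}, where Dinv stands for D^-1. *)
Definition is_green T (Dinv : distr T -> distr T) (psi : circle T -> R) : Prop :=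
  represents psi (Dinv (dirac_comb T)).

End distributions.

Section radon_measures.
Context {R : realType}.
Implicit Type T : R.

(* Finite signed Borel measures; on the circle, a compact metrizable space, every
   such measure is Radon. *)
Definition radon T : Type := {charge set (circle T) -> \bar R}.

(* \int phi dm, through the Jordan decomposition of m. The Hahn decomposition is
   unique up to null sets, so its choice is irrelevant. *)
Definition pairing T (m : radon T) (phi : circle T -> R) : R :=
  let PN := svalP (cid (svalP (cid (Hahn_decomposition m)))) in
  \int[jordan_pos PN]_t phi t - \int[jordan_neg PN]_t phi t.

(* Both suprema below are suprema of bounded nonempty sets of reals: phi is only
   taken continuous, and m is finite. *)
Definition sup_norm T (phi : circle T -> R) : R :=
  sup (range (fun t => `|phi t|)).

Definition TV_norm T (m : radon T) : R :=
  sup [set pairing m phi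
      | phi in [set phi : circle T -> R | continuous phi /\ sup_norm phi <= 1]].

(* Equality of measures. Leibniz equality would also compare the meaningless
   values taken on non-measurable sets. *)
Definition radon_eq T (m m' : radon T) : Prop :=
  forall A, measurable A -> m A = m' A.

Definition dirac_impulse T (tau : circle T) : radon T :=
  charge_of_finite_measure (dirac tau : {finite_measure set _ -> \bar R}).

Definition radon_scale T (a : R) (m : radon T) : radon T := cscale a m.

Definition radon_add T (m m' : radon T) : radon T := cadd m m'.

Definition dirac_sum T (P : nat) (tau : 'I_P -> circle T) (beta : 'cV[R]_P) :
    radon T :=
  \big[@radon_add T / (czero : radon T)]_(p < P)
    radon_scale (beta p 0) (dirac_impulse (tau p)).

End radon_measures.

Section measurement.
Context {R : realType}.
Variables (T : R) (psi : circle T -> R) (L : nat) (theta : 'I_L -> circle T).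

Definition measurement (m : radon T) : 'cV[R]_L :=
  \col_l pairing m (fun t => psi (theta l - t)).

Definition measurement_adj (h : 'cV[R]_L) (t : circle T) : R :=
  \sum_(l < L) h l 0 * psi (theta l - t).

Definition primal_solution (y0 : 'cV[R]_L) (m : radon T) : Prop :=
  measurement m = y0 /\
  forall m', measurement m' = y0 -> TV_norm m <= TV_norm m'.

Definition dual_certificate (y0 : 'cV[R]_L) (eta : circle T -> R) : Prop :=
  [/\ continuous eta, exists h, eta = measurement_adj h, sup_norm eta <= 1
    & forall m, primal_solution y0 m -> pairing m eta = TV_norm m].

Definition Sat (eta : circle T -> R) : set (circle T) :=
  [set t | eta t = 1 \/ eta t = -1].

Definition sampling_matrix (P : nat) (tau : 'I_P -> circle T) : 'M[R]_(L, P) :=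
  \matrix_(l, p) psi (theta l - tau p).

End measurement.

(* Main.v *)
Require Import Defs.
From mathcomp Require Import finmap.
From mathcomp Require Import all_boot all_order all_algebra.
From mathcomp Require Import all_classical all_reals all_analysis.
From mathcomp Require Import measurable_realfun.
From mathcomp Require Import ring lra.

Import Order.TTheory GRing.Theory Num.Theory.
Import numFieldNormedType.Exports.

Local Open Scope classical_set_scope.
Local Open Scope ring_scope.

(** Uniqueness. A primal solution [m] pairs with the certificate [eta] to its
    norm, so [eta] maximises the pairing with [m] over the unit ball of continuous
    functions. A continuous [phi] bounded by a multiple of 1 - |eta| can be added
    to or subtracted from [eta], up to a factor, without leaving the ball; hence
    [m] vanishes on it ([pairing_slack_eq0]). Such functions increase to the
    indicators of the open subsets of the region |eta| < 1, so [m] is null there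
    ([extremal_null_off_saturation]) and is a combination of the Dirac impulses at
    the saturation points ([extremal_discrete]). Its weights solve the linear
    system whose matrix is [sampling_matrix psi theta tau]; when that map is
    injective, two solutions have the same weights.

    Existence. The condition on the certificate speaks only of solutions, so it
    produces none. As there are only [L] measurements, weak-* compactness of the
    unit ball of measures is replaced by a finite-dimensional argument: the
    measurements of any [m] are those of [L] weighted points whose absolute
    weights add up to at most [TV_norm m] ([atoms_of_functional]). They are
    obtained by discretising [m] along a partition of unity, reducing the number
    of atoms to [L] ([caratheodory]), and passing to the limit in a compact set of
    weights and places. The total weight attains its minimum on [L] exact atoms
    ([minimal_atoms]), and the minimiser is a primal solution
    ([primal_solution_exists]).

    The pairing of a measure with a function is defined by a chosen Hahn
    decomposition; [pairing_splits] shows that any way of writing the measure as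
    a difference of finite measures computes it, and linearity follows. *)

Set Implicit Arguments.
Unset Strict Implicit.
Unset Printing Implicit Defensive.

(** * Reduction of the number of atoms *)

(** More vectors than dimensions satisfy a linear relation [d]. Subtracting from
    [c] a growing multiple of [d] until a first coordinate vanishes changes no
    sign, so the l1-norm varies linearly along the way; it does not increase,
    for one of the two choices of sign of [d]. *)
Lemma drop_atom (R : realFieldType) (n L : nat) (v : 'M[R]_(n.+1, L))
    (c : 'I_n.+1 -> R) : (L <= n)%N ->
  exists (c' : 'I_n.+1 -> R) (k : 'I_n.+1),
    [/\ c' k = 0, \sum_i `|c' i| <= \sum_i `|c i|
      & forall l, \sum_i c' i * v i l = \sum_i c i * v i l].
Proof.
move=> Ln; have [[k ck0]|c0] := pselect (exists k, c k = 0).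
  by exists c, k.
have {}c0 i : c i != 0 by apply/eqP => ci0; apply: c0; exists i.
have [d0 d0N0 d0v] : exists2 d : 'rV[R]_n.+1, d != 0 & d *m v = 0.
  have : kermx v != 0.
    by rewrite kermx_eq0 /row_free neq_ltn ltnS (leq_trans (rank_leq_col v)).
  by case/rowV0Pn=> d /sub_kermxP dv dN0; exists d.
(* The sum is minus the derivative of the l1-norm at c along -d. *)
have [d dN0 [dv dS]] : exists2 d : 'rV[R]_n.+1, d != 0 &
    d *m v = 0 /\ 0 <= \sum_i `|c i| * (d 0 i / c i).
  have [S0|S0] := leP 0 (\sum_i `|c i| * (d0 0 i / c i)); first by exists d0.
  exists (- d0); first by rewrite oppr_eq0.
  split; first by rewrite mulNmx d0v oppr0.
  rewrite (_ : \sum_i _ = - \sum_i `|c i| * (d0 0 i / c i)).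
    by rewrite oppr_ge0 ltW.
  by rewrite -sumrN; apply: eq_bigr => i _; rewrite mxE mulNr mulrN.
(* c - s d has coordinates c_i (1 - s r_i), for r_i = d_i / c_i; the first one
   to vanish has the largest r_i. *)
pose rt i := d 0 i / c i.
have [k _ kmax] := @Order.TotalTheory.arg_maxP _ _ _ ord0 xpredT rt isT.
have rk0 : 0 < rt k.
  rewrite ltNge; apply/negP => rk0.
  have rle i : rt i <= 0 by apply: le_trans rk0; exact: kmax.
  have S0 : \sum_i `|c i| * (- rt i) == 0.
    rewrite eq_le sumr_ge0 ?andbT; last first.
      by move=> i _; rewrite mulr_ge0// oppr_ge0.
    rewrite (_ : \sum_i _ = - \sum_i `|c i| * (d 0 i / c i)) ?oppr_le0//.
    by rewrite -sumrN; apply: eq_bigr => i _; rewrite mulrN.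
  move: S0; rewrite psumr_eq0; last by move=> i _; rewrite mulr_ge0// oppr_ge0.
  move=> /allP S0; case/eqP: dN0; apply/rowP => i.
  have := S0 i; rewrite mem_index_enum => /(_ isT)/=.
  rewrite mulf_eq0 normr_eq0 (negbTE (c0 i)) oppr_eq0/= /rt mulf_eq0.
  by rewrite invr_eq0 (negbTE (c0 i)) orbF mxE => /eqP.
exists (fun i => c i * (1 - rt i / rt k)), k; split.
- by rewrite divff ?gt_eqF// subrr mulr0.
- rewrite (_ : \sum_i `|c i * _| =
      \sum_i `|c i| - (rt k)^-1 * \sum_i `|c i| * (d 0 i / c i)); last first.
    rewrite mulr_sumr -sumrB; apply: eq_bigr => i _.
    rewrite normrM (@ger0_norm _ (1 - _)).
      by rewrite mulrBr mulr1; congr (_ - _); rewrite /rt; ring.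
    by rewrite subr_ge0 ler_pdivrMr// mul1r; exact: kmax.
  by rewrite lerBlDr lerDl mulr_ge0// invr_ge0 ltW.
- move=> l; have dvl : \sum_i d 0 i * v i l = 0.
    by have := congr1 (fun M : 'rV_L => M 0 l) dv; rewrite !mxE.
  transitivity (\sum_i c i * v i l - (rt k)^-1 * \sum_i d 0 i * v i l).
    rewrite mulr_sumr -sumrB; apply: eq_bigr => i _.
    rewrite mulrBr mulr1 mulrBl; congr (_ - _).
    rewrite /rt mulrA [c i * _]mulrC divfK//; ring.
  by rewrite dvl mulr0 subr0.
Qed.

(** Atoms are dropped one at a time while there are more than [L] of them; a
    short list is padded with zero weights, whose places [x0] are irrelevant. *)
Lemma caratheodory (R : realFieldType) (X : Type) (x0 : X) (L : nat)
    (v : 'I_L -> X -> R) (n : nat) (c : 'I_n -> R) (t : 'I_n -> X) :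
  exists (c' : 'I_L -> R) (t' : 'I_L -> X),
    \sum_i `|c' i| <= \sum_i `|c i| /\
    forall l, \sum_i c' i * v l (t' i) = \sum_i c i * v l (t i).
Proof.
suff gen N : (L <= N)%N -> exists (c' : 'I_N -> R) (t' : 'I_N -> X),
    \sum_i `|c' i| <= \sum_i `|c i| /\
    forall l, \sum_i c' i * v l (t' i) = \sum_i c i * v l (t i) by exact: gen.
move=> LN; elim: n c t => [|n IHn] c t.
  exists (fun=> 0), (fun=> x0); split.
    by rewrite big_ord0 big1// => i _; rewrite normr0.
  by move=> l; rewrite big_ord0 big1// => i _; rewrite mul0r.
have [nN|Nn] := leqP n.+1 N.
  rewrite -(subnKC nN); set k := (N - n.+1)%N.
  exists (fun i => if fintype.split i is inl j then c j else 0).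
  exists (fun i => if fintype.split i is inl j then t j else x0).
  split=> [|l]; rewrite big_split_ord/= [X in _ + X]big1 ?addr0.
  - by apply: ler_sum => i _; rewrite (unsplitK (inl i)).
  - by move=> i _; rewrite (unsplitK (inr i)) normr0.
  - by apply: eq_bigr => i _; rewrite (unsplitK (inl i)).
  - by move=> i _; rewrite (unsplitK (inr i)) mul0r.
have [] := @drop_atom _ n L (\matrix_(i, l) v l (t i)) c.
  by rewrite -ltnS (leq_ltn_trans LN).
move=> c1 [k [c1k c1c c1v]].
have [c' [t' [c'le c'v]]] := IHn (fun i => c1 (lift k i)) (fun i => t (lift k i)).
exists c', t'; split.
  by rewrite (le_trans c'le)// (le_trans _ c1c)// (bigD1_ord k)//= c1k normr0 add0r.
move=> l; rewrite c'v; have := c1v l; rewrite (bigD1_ord k)//= c1k mul0r add0r.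
by under eq_bigr do rewrite mxE; under [in RHS]eq_bigr do rewrite mxE.
Qed.

(** * Atomic representation of functionals on a compact space *)

Section continuous_real_functions.
Context {R : realType} {X : topologicalType}.
Implicit Types f g : X -> R.

Lemma continuous_const (a : R) : continuous (fun _ : X => a).
Proof. by move=> x; exact: cvg_cst. Qed.

Lemma continuous_add f g :
  continuous f -> continuous g -> continuous (fun x => f x + g x).
Proof. by move=> fc gc x; apply: cvgD; [exact: fc|exact: gc]. Qed.

Lemma continuous_sub f g :
  continuous f -> continuous g -> continuous (fun x => f x - g x).
Proof. by move=> fc gc x; apply: cvgB; [exact: fc|exact: gc]. Qed.

Lemma continuous_mul f g :
  continuous f -> continuous g -> continuous (fun x => f x * g x).
Proof. by move=> fc gc x; apply: cvgM; [exact: fc|exact: gc]. Qed.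

Lemma continuous_scale (a : R) f :
  continuous f -> continuous (fun x => a * f x).
Proof. exact/continuous_mul/continuous_const. Qed.

Lemma continuous_norm f : continuous f -> continuous (fun x => `|f x|).
Proof. by move=> fc x; apply: cvg_norm; exact: fc. Qed.

Lemma continuous_sum (I : Type) (s : seq I) (f : I -> X -> R) :
  (forall i, continuous (f i)) -> continuous (fun x => \sum_(i <- s) f i x).
Proof.
move=> fc; elim: s => [|i s IHs].
  rewrite (_ : (fun x => _) = cst 0); first exact: continuous_const.
  by apply/funext => z; rewrite big_nil.
rewrite (_ : (fun x => _) = fun z => f i z + \sum_(j <- s) f j z).
  by apply: continuous_add; [exact: fc|exact: IHs].
by apply/funext => z; rewrite big_cons.
Qed.

Lemma continuous_max0 f : continuous f -> continuous (fun x => Num.max 0 (f x)).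
Proof.
by move=> fc x; apply: (@continuous_max _ _ (fun=> 0) f);
  [exact: cvg_cst|exact: fc].
Qed.

Lemma continuous_min1 f : continuous f -> continuous (fun x => Num.min 1 (f x)).
Proof.
by move=> fc x; apply: (@continuous_min _ _ (fun=> 1) f);
  [exact: cvg_cst|exact: fc].
Qed.

End continuous_real_functions.

(** Tents of height [e] around finitely many points [t i], measured in the
    pseudo-distance induced by the functions [v l], and then normalised. No
    metric on [X] is involved: [v] itself provides the small sets. *)
Lemma partition_of_unity (R : realType) (X : ptopologicalType) (L : nat)
    (v : 'I_L -> X -> R) (e : R) :
    compact [set: X] -> (forall l, continuous (v l)) -> 0 < e ->
  exists (n : nat) (t : 'I_n -> X) (phi : 'I_n -> X -> R),
    [/\ forall i, continuous (phi i),
        forall i x, 0 <= phi i x,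
        forall x, \sum_i phi i x = 1
      & forall i x l, phi i x != 0 -> `|v l (t i) - v l x| <= e].
Proof.
move=> cX vc e0.
pose gap y x := \sum_l `|v l y - v l x|.
pose rho y x := Num.max 0 (e - gap y x).
have gapc y : continuous (gap y).
  apply: continuous_sum => l; apply/continuous_norm/continuous_sub => //.
  exact: continuous_const.
have rhoc y : continuous (rho y).
  by apply/continuous_max0/continuous_sub => //; exact: continuous_const.
have rho0 y x : 0 <= rho y x by rewrite le_max lexx.
have rhogt y x : (0 < rho y x) = (gap y x < e).
  by rewrite lt_max ltxx/= subr_gt0.
have [D _ covD] : finite_subset_cover [set: X] (fun y => [set x | gap y x < e])
    [set: X].
  move: cX; rewrite compact_cover; apply.
    move=> y _; rewrite (_ : [set _ | _] = gap y @^-1` [set z | z < e])//.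
    by apply: open_comp => [x _|]; [exact: gapc|exact: open_lt].
  by move=> x _; exists x => //=; rewrite /gap big1// => l _; rewrite subrr normr0.
pose s := enum_fset D.
pose S x := \sum_(y <- s) rho y x.
have S0 x : 0 < S x.
  have [y yD /= yx] := covD x I.
  rewrite /S (big_rem y)//=; apply: ltr_pwDl; first by rewrite rhogt.
  by apply: sumr_ge0.
exists (size s), (fun i => tnth (in_tuple s) i).
exists (fun i x => rho (tnth (in_tuple s) i) x / S x); split.
- move=> i x; apply: cvgM; first exact: rhoc.
  apply: cvgV; first by rewrite gt_eqF.
  by apply: continuous_sum => y; exact: rhoc.
- by move=> i x; rewrite divr_ge0 ?rho0// ltW.
- move=> x; rewrite -mulr_suml -(big_tnth _ _ s xpredT (fun y => rho y x)).
  by rewrite -/(S x) divff// gt_eqF.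
- move=> i x l; rewrite mulf_eq0 negb_or => /andP[rN0 _].
  have : 0 < rho (tnth (in_tuple s) i) x by rewrite lt0r rN0 rho0.
  rewrite rhogt => /ltW; apply: le_trans.
  by rewrite /gap (bigD1 l)//= lerDl sumr_ge0.
Qed.

Section atoms.
Context {R : realType} {X : ptopologicalType} {L : nat}.
Variables (v : 'I_L -> X -> R) (y : 'I_L -> R).

(** [L] weighted points of [X], with the product topology. *)
Local Notation atoms := (prod_topology (fun _ : 'I_L => (R * X)%type)).

Definition mass (f : atoms) : R := \sum_i `|(f i).1|.

Definition misfit (f : atoms) : R :=
  \sum_l `|y l - \sum_i (f i).1 * v l (f i).2|.

Hypothesis cX : compact [set: X].
Hypothesis vc : forall l, continuous (v l).

Let weight_continuous i : continuous (fun f : atoms => (f i).1).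
Proof.
move=> f; apply: (@continuous_comp _ _ _ (fun f : atoms => f i) fst).
  exact: proj_continuous.
exact: cvg_fst.
Qed.

Let place_continuous i : continuous (fun f : atoms => (f i).2).
Proof.
move=> f; apply: (@continuous_comp _ _ _ (fun f : atoms => f i) snd).
  exact: proj_continuous.
exact: cvg_snd.
Qed.

Lemma mass_continuous : continuous mass.
Proof.
by apply: continuous_sum => i; exact/continuous_norm/weight_continuous.
Qed.

Lemma misfit_continuous : continuous misfit.
Proof.
apply: continuous_sum => l; apply/continuous_norm/continuous_sub.
  exact: continuous_const.
apply: continuous_sum => i; apply: continuous_mul; first exact: weight_continuous.
move=> f; apply: (@continuous_comp _ _ _ (fun f : atoms => (f i).2) (v l)).
  exact: place_continuous.
exact: vc.
Qed.

Lemma mass_ball_compact (r : R) : compact [set f | mass f <= r].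
Proof.
rewrite (_ : [set _ | _] =
  [set f : atoms | forall i, (`[- r, r] `*` [set: X]) (f i)] `&`
  [set f | mass f <= r]); last first.
  apply/seteqP; split=> f; last by case.
  move=> /= fr; split=> // i; split=> //=; rewrite in_itv/= -ler_norml.
  by apply: le_trans fr; rewrite /mass (bigD1 i)//= lerDl sumr_ge0.
apply: compact_closedI.
  apply: (@tychonoff 'I_L (fun=> (R * X)%type)
     (fun=> `[- r, r] `*` [set: X])) => i.
  by apply: compact_setX => //; exact: segment_compact.
by apply: closed_comp (@closed_le _ r) => f _; exact: mass_continuous.
Qed.

Lemma misfit_ge0 f : 0 <= misfit f.
Proof. exact: sumr_ge0. Qed.

Lemma misfit_eq0 f :
  misfit f = 0 -> forall l, y l = \sum_i (f i).1 * v l (f i).2.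
Proof.
move=> /eqP; rewrite psumr_eq0// => /allP f0 l; apply/eqP; rewrite -subr_eq0.
by rewrite -normr_eq0; apply: (f0 l); rewrite mem_index_enum.
Qed.

Lemma exact_atoms_limit (r : R) :
  (forall e, 0 < e -> exists2 f, mass f <= r & misfit f <= e) ->
  exists2 f, mass f <= r & misfit f = 0.
Proof.
move=> approx.
have [] := @compact_EVT_min _ _ misfit [set f | mass f <= r].
- by have [f fr _] := approx 1 ltr01; exists f.
- exact: mass_ball_compact.
- exact/continuous_subspaceT/misfit_continuous.
move=> f; rewrite inE/= => fr fmin; exists f => //; apply/eqP.
rewrite eq_le misfit_ge0 andbT; apply/ler_addgt0Pr => e e0; rewrite add0r.
by have [g gr ge] := approx e e0; apply: le_trans ge; apply: fmin; rewrite inE.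
Qed.

Lemma minimal_atoms (f0 : atoms) : misfit f0 = 0 ->
  exists2 f, misfit f = 0 & forall g, misfit g = 0 -> mass f <= mass g.
Proof.
move=> f00.
have [] := @compact_EVT_min _ _ mass
  ([set f | mass f <= mass f0] `&` [set f | misfit f <= 0]).
- by exists f0; rewrite /= f00.
- apply: compact_closedI; first exact: mass_ball_compact.
  by apply: closed_comp (@closed_le _ 0) => f _; exact: misfit_continuous.
- exact/continuous_subspaceT/mass_continuous.
move=> f; rewrite inE => -[/= ff0 f_0] fmin; exists f.
  by apply/eqP; rewrite eq_le misfit_ge0 f_0.
move=> g g0; have [gf0|/ltW] := leP (mass g) (mass f0); last exact: le_trans.
by apply: fmin; rewrite inE/= g0.
Qed.

(** Testing [Lam] on a partition of unity [phi] gives weights [Lam (phi i)]. Their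
    l1-norm is the value of [Lam] on a signed combination of the [phi i], a
    function bounded by 1, hence at most [r]; and the moments of the weights
    placed at the [t i] approach those of [Lam]. The number of atoms grows with
    the precision, so Caratheodory's reduction is needed before compactness can
    turn the approximate solutions into an exact one. *)
Lemma atoms_of_functional (Lam : (X -> R) -> R) (r : R) :
    (forall f g : X -> R, continuous f -> continuous g ->
       Lam (fun x => f x + g x) = Lam f + Lam g) ->
    (forall (a : R) (f : X -> R), continuous f ->
       Lam (fun x => a * f x) = a * Lam f) ->
    (forall f : X -> R, continuous f -> (forall x, `|f x| <= 1) -> Lam f <= r) ->
    (forall l, y l = Lam (v l)) ->
  exists2 f, mass f <= r & misfit f = 0.
Proof.
move=> LamD LamZ Lamr yE.
have c0 : continuous (fun _ : X => 0 : R) by exact: continuous_const.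
have Lam0 : Lam (fun=> 0) = 0.
  rewrite -[RHS](mul0r (Lam (fun=> 0))) -LamZ//; congr Lam.
  by apply/funext => x; rewrite mul0r.
have r0 : 0 <= r by rewrite -Lam0; apply: Lamr => // x; rewrite normr0.
have Lam_sum n (f : 'I_n -> X -> R) : (forall i, continuous (f i)) ->
    Lam (fun x => \sum_i f i x) = \sum_i Lam (f i).
  move=> fc; suff H (s : seq 'I_n) :
    Lam (fun x => \sum_(i <- s) f i x) = \sum_(i <- s) Lam (f i) by exact: H.
  elim: s => [|i s IHs].
    by rewrite big_nil -[RHS]Lam0; congr Lam; apply/funext => x; rewrite big_nil.
  rewrite big_cons -IHs -LamD//; last exact: continuous_sum.
  by congr Lam; apply/funext => x; rewrite big_cons.
have Lamle e f : 0 < e -> continuous f -> (forall x, `|f x| <= e) ->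
    `|Lam f| <= r * e.
  move=> e0 fc fe; have /= H s : `|s| = 1 -> s * Lam f <= r * e.
    move=> s1; rewrite -ler_pdivrMr// mulrAC -LamZ//.
    apply: Lamr => [|x]; first exact: continuous_scale.
    rewrite !normrM s1 mul1r normfV (gtr0_norm e0) mulrC.
    by rewrite ler_pdivrMr// mul1r.
  rewrite ler_norml -lerN2 opprK -mulN1r H ?normrN1//=.
  by rewrite -[leLHS]mul1r H ?normr1.
apply: exact_atoms_limit => e e0.
(* There are L moments, each with error at most r * e'; the + 1 keeps
   the denominator positive. *)
pose e' := e / (L%:R * r + 1).
have d0 : 0 < L%:R * r + 1 by rewrite ltr_wpDl// mulr_ge0.
have e'0 : 0 < e' by rewrite divr_gt0.
have [n [t [phi [phic phi0 phi1 phiv]]]] := partition_of_unity cX vc e'0.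
have [c [t' [c_le cE]]] :=
  @caratheodory R X point L v n (fun i => Lam (phi i)) t.
exists (fun i => (c i, t' i)).
  apply: (le_trans c_le).
  have -> : \sum_i `|Lam (phi i)| =
      Lam (fun x => \sum_i Num.sg (Lam (phi i)) * phi i x).
    rewrite Lam_sum => [|i]; last exact: continuous_scale.
    by apply: eq_bigr => i _; rewrite LamZ// -normrEsg.
  apply: Lamr => [|x].
    by apply: continuous_sum => i; exact: continuous_scale.
  rewrite -(phi1 x) (le_trans (ler_norm_sum _ _ _))//; apply: ler_sum => i _.
  rewrite normrM (ger0_norm (phi0 _ _)) ler_piMl// normr_sg.
  by case: eqP.
rewrite /misfit; under eq_bigr do rewrite cE.
apply: (@le_trans _ _ (\sum_(l < L) r * e')); last first.
  rewrite sumr_const card_ord -mulr_natl /e' mulrA mulrA ler_pdivrMr//.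
  by rewrite [L%:R * r * e]mulrC ler_wpM2l ?ltW// ltrDl.
apply: ler_sum => l _; rewrite yE.
have -> : Lam (v l) - \sum_i Lam (phi i) * v l (t i) =
    Lam (fun x => \sum_i (v l x - v l (t i)) * phi i x).
  have gc i : continuous (fun x => (v l x - v l (t i)) * phi i x).
    apply: continuous_mul => //; apply: continuous_sub => //.
    exact: continuous_const.
  rewrite (_ : (fun x => _) = (fun x => v l x + \sum_i (- v l (t i)) * phi i x)).
    have hc i : continuous (fun x => (- v l (t i)) * phi i x).
      exact: continuous_scale.
    rewrite LamD//; last exact: continuous_sum.
    rewrite Lam_sum// -sumrN; congr (_ + _); apply: eq_bigr => i _.
    by rewrite LamZ// mulNr mulrC.
  apply/funext => x; rewrite -[X in X + _]mulr1 -(phi1 x) mulr_sumr -big_split.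
  by apply: eq_bigr => i _ /=; rewrite mulrBl mulNr.
apply: Lamle => // [|x].
  apply: continuous_sum => i; apply: continuous_mul => //.
  by apply: continuous_sub => //; exact: continuous_const.
rewrite (le_trans (ler_norm_sum _ _ _))//.
rewrite -[leRHS]mulr1 -(phi1 x) mulr_sumr; apply: ler_sum => i _.
rewrite normrM (ger0_norm (phi0 _ _)).
have [->|pN0] := eqVneq (phi i x) 0; first by rewrite !mulr0.
by rewrite ler_wpM2r// distrC; exact: phiv.
Qed.

End atoms.

(** * Topology and Borel sets of the circle *)

Section circle_geometry.
Context {R : realType} (T : R).
Hypothesis T0 : 0 < T.

Lemma to_circle_surj (t : circle T) : exists x, to_circle T x = t.
Proof. by exists (repr t); rewrite /to_circle reprK. Qed.

Lemma to_circle_eq0 (x : R) :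
  to_circle T x = 0 <-> exists k : int, x = T *~ k.
Proof.
have -> : (to_circle T x = 0) = (x \in periods T).
  rewrite -(to_circle0 T) -[x in RHS]subr0 (Quotient.idealrBE (periods T)).
  by apply/propext; split=> [h|/eqP//]; exact/eqP.
by split=> /asboolP.
Qed.

Lemma to_circle_period (k : int) : to_circle T (T *~ k) = 0.
Proof. by apply/to_circle_eq0; exists k. Qed.

Lemma to_circleB (x y : R) : to_circle T (x - y) = to_circle T x - to_circle T y.
Proof. by apply: (addIr (to_circle T y)); rewrite -to_circleD !subrK. Qed.

Lemma to_circle_continuous : continuous (to_circle T).
Proof. exact: (@pi_continuous _ (Quotient.quot (periods T))). Qed.

Lemma continuous_lift (Z : topologicalType) (f : circle T -> Z) :
  continuous (f \o to_circle T) -> continuous f.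
Proof. by move=> fc; apply/quotient_continuous. Qed.

Lemma open_lift (U : set (circle T)) :
  open (to_circle T @^-1` U) <-> open U.
Proof. by []. Qed.

Lemma period_floor (x : R) : exists k : int, T *~ k <= x < T *~ (k + 1).
Proof.
exists (Num.floor (x / T)); rewrite -!(mulrzr T).
have /andP[l u] := real_floor_itv (num_real (x / T)).
by rewrite ![T * _]mulrC -ler_pdivlMr// -ltr_pdivrMr// l.
Qed.

Lemma circle_compact : compact [set: circle T].
Proof.
have -> : [set: circle T] = to_circle T @` `[0, T]%classic.
  apply/seteqP; split=> // t _; have [x <-] := to_circle_surj t.
  have [k /andP[kx xk]] := period_floor x.
  exists (x - T *~ k); last by rewrite to_circleB to_circle_period subr0.
  rewrite /= in_itv/= subr_ge0 kx/= lerBlDr addrC ltW//.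
  by rewrite mulrzDr in xk.
apply: continuous_compact; last exact: segment_compact.
exact/continuous_subspaceT/to_circle_continuous.
Qed.

(** The lift of the complement of a point is a union of open intervals of length
    [T]. *)
Lemma circle_accessible (a : circle T) : open (~` [set a]).
Proof.
have [x xa] := to_circle_surj a.
suff : open (to_circle T @^-1` (~` [set a])) by [].
suff -> : to_circle T @^-1` (~` [set a]) =
    \bigcup_(k in [set: int]) `]x + T *~ k, x + T *~ (k + 1)[%classic.
  by apply: bigcup_open => k _; exact: itv_open.
apply/seteqP; split=> [y /= ya|y [k _]/=].
  have [k /andP[ky yk]] := period_floor (y - x).
  exists k => //=; rewrite in_itv/= -ltrBrDl -[y < _]ltrBlDl yk andbT.
  rewrite lt_neqAle ky andbT; apply/eqP => kyx; apply: ya.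
  by rewrite -xa -[y](subrK x) -kyx to_circleD to_circle_period add0r.
rewrite in_itv/= -ltrBrDl -[y < _]ltrBlDl => /andP[ky yk] ya.
have /to_circle_eq0[j yxj] : to_circle T (y - x) = 0.
  by rewrite to_circleB ya xa subrr.
move: ky yk; rewrite yxj !ltr_pMz2l// ltzD1 => /lt_le_trans /[apply].
by rewrite ltxx.
Qed.

Lemma circle_measurable_open (U : set (circle T)) : open U -> measurable U.
Proof. by move=> oU; exact: sub_sigma_algebra. Qed.

Lemma circle_measurable_set1 (a : circle T) : measurable [set a].
Proof.
have := measurableC (circle_measurable_open (@circle_accessible a)).
by rewrite setCK.
Qed.

Lemma circle_measurable_fun (f : circle T -> R) :
  continuous f -> measurable_fun setT f.
Proof.
move=> /continuousP fc; apply: (measurability _ (RGenOpens.measurableE R)).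
move=> _ [_ [a [b ->] <-]]; rewrite setTI.
apply: circle_measurable_open; apply: fc; exact: itv_open.
Qed.

Lemma circle_measurable_gt0 (u : circle T -> R) :
  continuous u -> measurable [set t | 0 < u t].
Proof.
move=> /continuousP uc; apply: circle_measurable_open.
rewrite (_ : [set _ | _] = u @^-1` [set x | 0 < x])//.
by apply: uc; exact: open_gt.
Qed.

Section depth.
Variables (U : set (circle T)).
Hypothesis UT : U <> setT.

(** The distance from [t] to the complement of [U], for the arc length: [x] runs
    over all the lifts of displacements from [t] into that complement. *)
Definition depth (t : circle T) : R :=
  inf [set `|x| | x in [set x | ~ U (t - to_circle T x)]].

Let has_inf_depth t :
  has_inf [set `|x| | x in [set x | ~ U (t - to_circle T x)]].
Proof.
split; last by exists 0 => _ [x _ <-].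
have [s Us] : exists s, ~ U s.
  by apply/existsNP => UA; apply: UT; apply/seteqP; split.
have [x xts] := to_circle_surj (t - s); exists `|x|, x => //=.
by rewrite xts opprB addrC subrK.
Qed.

Lemma depth_lipschitz t h : depth (t + to_circle T h) <= depth t + `|h|.
Proof.
rewrite -lerBlDr; apply: lb_le_inf; first by case: (has_inf_depth t).
move=> _ [x /= Ux <-]; rewrite lerBlDr.
apply: (@le_trans _ _ `|x + h|); last exact: ler_normD.
apply: ge_inf; first by case: (has_inf_depth (t + to_circle T h)).
by exists (x + h) => //=; rewrite to_circleD opprD addrACA subrr addr0.
Qed.

Lemma depth_continuous : continuous depth.
Proof.
apply: continuous_lift => x; apply/cvgrPdist_le => e e0; near=> z.
have le y y' : depth (to_circle T y) - depth (to_circle T y') <= `|y - y'|.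
  by rewrite lerBlDl -{1}(subrK y' y) addrC to_circleD depth_lipschitz.
have : `|x - z| <= e by near: z; apply: cvgr_dist_le => //; exact: cvg_id.
apply: le_trans; rewrite /= ler_norml le andbT lerNl opprB.
by rewrite distrC le.
Unshelve. all: by end_near. Qed.

Lemma depth_out t : ~ U t -> depth t = 0.
Proof.
move=> Ut; apply/eqP; rewrite eq_le; apply/andP; split.
  apply: ge_inf; first by case: (has_inf_depth t).
  by exists 0; rewrite ?normr0//= to_circle0 subr0.
by apply: lb_le_inf => [|_ [x _ <-]//]; case: (has_inf_depth t).
Qed.

Lemma depth_gt0 t : open U -> U t -> 0 < depth t.
Proof.
move=> oU; have [x <-] := to_circle_surj t => Ux.
have /nbhs_ballP[e /= e0 eU] : nbhs x (to_circle T @^-1` U).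
  by apply: open_nbhs_nbhs; split=> //; exact/open_lift.
apply: lt_le_trans e0 _; apply: lb_le_inf.
  by case: (has_inf_depth (to_circle T x)).
move=> _ [y /= Uy <-]; rewrite leNgt; apply/negP => ye; apply: Uy.
by rewrite -to_circleB; apply: eU; rewrite /ball/= opprB addrC subrK.
Qed.

End depth.

(** The circle is defined as a quotient topological space, without a metric, so
    the function that exhibits an open set as a positivity set is built by hand.
    The full circle is treated apart, as [depth] would be the infimum of an empty
    set. *)
Lemma open_positivity_set (U : set (circle T)) : open U ->
  exists2 d : circle T -> R, continuous d &
    (forall t, 0 <= d t) /\ U = [set t | 0 < d t].
Proof.
move=> oU; have [->|UT] := pselect (U = setT).
  exists (fun=> 1); first exact: continuous_const.
  by split=> //; apply/seteqP; split=> t //= _; exact: ltr01.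
exists (depth U); first exact: depth_continuous.
split=> [t|].
  have [Ut|Ut] := pselect (U t); first by rewrite ltW// depth_gt0.
  by rewrite depth_out.
apply/seteqP; split=> t /=; first exact: depth_gt0.
by move=> dt; apply: contrapT => Ut; rewrite depth_out// ltxx in dt.
Qed.

End circle_geometry.

(** * Pairing of measures with continuous functions *)

Section pairing_calculus.
Context {R : realType} (T : R).
Hypothesis T0 : 0 < T.
Implicit Types (m : radon T) (mu nu : {measure set (circle T) -> \bar R}).
Implicit Types f g phi : circle T -> R.

Lemma continuous_circle_bounded phi :
  continuous phi -> exists M : R, forall t, `|phi t| <= M.
Proof.
move=> phic; have [] := @compact_EVT_max _ _ (fun t => `|phi t|) [set: circle T].
- by exists 0.
- exact: circle_compact.
- exact/continuous_subspaceT/continuous_norm.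
by move=> t _ tmax; exists `|phi t| => s; apply: tmax; rewrite inE.
Qed.

Lemma continuous_integrable mu phi : (mu setT < +oo)%E -> continuous phi ->
  mu.-integrable setT (EFin \o phi).
Proof.
move=> muoo phic; apply: measurable_bounded_integrable => //.
  exact: circle_measurable_fun.
have [M phiM] := continuous_circle_bounded phic.
exists M; split=> [|x Mx t _]; first exact: num_real.
exact: le_trans (phiM t) (ltW Mx).
Qed.

(** Any difference of finite measures, minimal or not. This freedom is what makes
    [pairing] computable: sums and multiples of Jordan decompositions are in
    general not Jordan decompositions. *)
Definition splits m mu nu :=
  [/\ (mu setT < +oo)%E, (nu setT < +oo)%E
    & forall A, measurable A -> (m A = mu A - nu A)%E].

Let fin_measure mu A : measurable A -> (mu setT < +oo)%E -> mu A \is a fin_num.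
Proof. by move=> mA muoo; exact: lty_fin_num_fun. Qed.

Lemma Rintegral_measure_add mu nu phi :
  (mu setT < +oo)%E -> (nu setT < +oo)%E -> continuous phi ->
  \int[measure_add mu nu]_t phi t = \int[mu]_t phi t + \int[nu]_t phi t.
Proof.
move=> muoo nuoo phic; have imu := continuous_integrable muoo phic.
have inu := continuous_integrable nuoo phic.
rewrite /Rintegral integral_measure_add//.
by rewrite fineD//; exact: integrable_fin_num.
Qed.

Lemma jordan_split m : exists mu nu, splits m mu nu /\
  forall phi, pairing m phi = \int[mu]_t phi t - \int[nu]_t phi t.
Proof.
rewrite /pairing.
set PN := svalP (cid (svalP (cid (Hahn_decomposition m)))).
exists (jordan_pos PN), (jordan_neg PN); split => //; split.
- by apply: fin_num_fun_lty; exact: fin_num_measure.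
- by apply: fin_num_fun_lty; exact: fin_num_measure.
- by move=> A mA; rewrite (jordan_decomp PN mA) /cadd/= cscaleN1.
Qed.

(** If mu - nu = mu' - nu' then mu + nu' and mu' + nu are the same measure. *)
Lemma pairing_splits m mu nu phi : splits m mu nu -> continuous phi ->
  pairing m phi = \int[mu]_t phi t - \int[nu]_t phi t.
Proof.
move=> [muoo nuoo mE] phic.
have [mu' [nu' [[mu'oo nu'oo mE'] ->]]] := jordan_split m.
apply/eqP; rewrite subr_eq addrAC eq_sym subr_eq eq_sym; apply/eqP.
rewrite -!Rintegral_measure_add//; congr fine.
apply: eq_measure_integral => A mA _.
transitivity (mu' A + nu A)%E; first exact: measure_addE.
transitivity (mu A + nu' A)%E; last exact/esym/measure_addE.
have := mE' A mA; rewrite mE//.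
rewrite -(fineK (fin_measure mA muoo)) -(fineK (fin_measure mA nuoo)).
rewrite -(fineK (fin_measure mA mu'oo)) -(fineK (fin_measure mA nu'oo)).
rewrite -!EFinB -!EFinD => -[h].
congr EFin; apply/eqP; rewrite -subr_eq -addrA -[_ - fine (nu' A)]opprB.
by apply/eqP; lra.
Qed.

Lemma pairing_eq m m' phi : radon_eq m m' -> continuous phi ->
  pairing m phi = pairing m' phi.
Proof.
move=> mm' phic; have [mu [nu [[muoo nuoo mE] ->]]] := jordan_split m'.
by apply: pairing_splits => //; split=> // A mA; rewrite mm'// mE.
Qed.

Lemma pairingD m f g : continuous f -> continuous g ->
  pairing m (fun t => f t + g t) = pairing m f + pairing m g.
Proof.
move=> fc gc; have [mu [nu [[muoo nuoo _] mE]]] := jordan_split m.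
rewrite !mE !RintegralD//; do ?exact: continuous_integrable.
by rewrite opprD addrACA.
Qed.

Lemma pairingZ m (a : R) f : continuous f ->
  pairing m (fun t => a * f t) = a * pairing m f.
Proof.
move=> fc; have [mu [nu [[muoo nuoo _] mE]]] := jordan_split m.
by rewrite !mE !RintegralZl//; do ?exact: continuous_integrable; rewrite mulrBr.
Qed.

Lemma pairing_add m m' f : continuous f ->
  pairing (radon_add m m') f = pairing m f + pairing m' f.
Proof.
move=> fc; have [mu [nu [[muoo nuoo mE] ->]]] := jordan_split m.
have [mu' [nu' [[mu'oo nu'oo mE'] ->]]] := jordan_split m'.
rewrite (@pairing_splits _ (measure_add mu mu') (measure_add nu nu'))//.
  by rewrite !Rintegral_measure_add// opprD addrACA.
have addoo (l l' : {measure set (circle T) -> \bar R}) :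
    (l setT < +oo)%E -> (l' setT < +oo)%E -> (measure_add l l' setT < +oo)%E.
  move=> loo l'oo; rewrite (_ : measure_add l l' setT = (l setT + l' setT)%E).
    by rewrite lte_add_pinfty.
  exact: measure_addE.
split; [exact: addoo|exact: addoo|].
move=> A mA; transitivity (m A + m' A)%E; first by [].
transitivity ((mu A + mu' A) - (nu A + nu' A))%E.
  by rewrite mE// mE'// fin_num_oppeD ?fin_measure// addeACA.
by congr (_ - _)%E; exact/esym/measure_addE.
Qed.

Lemma pairing_zero f : continuous f -> pairing (czero : radon T) f = 0.
Proof.
move=> fc; rewrite (@pairing_splits _ mzero mzero) ?subrr//.
by split=> [||A mA]; rewrite /mzero/= ?ltry ?sube0.
Qed.

Let mscale_oo (k : {nonneg R}) mu :
  (mu setT < +oo)%E -> (mscale k mu setT < +oo)%E.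
Proof. by move=> muoo; rewrite /mscale/= lte_mul_pinfty// fin_measure. Qed.

(** Nonnegative functions come first, by [ge0_integral_mscale]; a bounded [f]
    reduces to them by adding and subtracting a constant. *)
Lemma Rintegral_mscale (k : {nonneg R}) mu f :
  (mu setT < +oo)%E -> continuous f ->
  \int[mscale k mu]_t f t = k%:num * \int[mu]_t f t.
Proof.
move=> muoo fc; have kmuoo := mscale_oo k muoo.
have scale_ge0 g : continuous g -> (forall t, 0 <= g t) ->
    \int[mscale k mu]_t g t = k%:num * \int[mu]_t g t.
  move=> gc g0; have mg : measurable_fun setT (EFin \o g).
    by apply/measurable_EFinP; exact: circle_measurable_fun.
  rewrite /Rintegral (@ge0_integral_mscale _ _ _ mu setT measurableT k)//;
    last by move=> t _; rewrite lee_fin.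
  rewrite fineM//; apply: integrable_fin_num => //.
  exact: continuous_integrable.
have [M fM] := continuous_circle_bounded fc.
have Mc : continuous (fun _ : circle T => M) by exact: continuous_const.
have gc : continuous (fun t => f t + M) by exact: continuous_add.
have fE (l : {measure set (circle T) -> \bar R}) : (l setT < +oo)%E ->
    \int[l]_t f t = \int[l]_t (f t + M) - \int[l]_(t in setT) (fun=> M) t.
  move=> loo; rewrite -RintegralB//; do ?exact: continuous_integrable.
  by apply: eq_Rintegral => t _; rewrite addrK.
rewrite !fE// !scale_ge0 ?mulrBr// => t.
  by apply: le_trans (fM t).
by rewrite -lerBlDr sub0r; have := fM t; rewrite ler_norml => /andP[].
Qed.

Lemma pairing_scale (a : R) m f : continuous f ->
  pairing (radon_scale a m) f = a * pairing m f.
Proof.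
move=> fc; have [mu [nu [[muoo nuoo mE] ->]]] := jordan_split m.
have [a0|a0] := leP 0 a.
  rewrite (@pairing_splits _ (mscale (NngNum a0) mu) (mscale (NngNum a0) nu))//.
    by rewrite !Rintegral_mscale//= mulrBr.
  split; [exact: mscale_oo|exact: mscale_oo|move=> A mA].
  transitivity (a%:E * m A)%E; first by [].
  by rewrite mE// muleBr// fin_num_adde_defr// fin_measure.
(* A negative factor exchanges the two measures. *)
have Na0 : 0 <= - a by rewrite oppr_ge0 ltW.
rewrite (@pairing_splits _ (mscale (NngNum Na0) nu) (mscale (NngNum Na0) mu))//.
  by rewrite !Rintegral_mscale//= mulrBr; lra.
split; [exact: mscale_oo|exact: mscale_oo|move=> A mA].
transitivity (a%:E * m A)%E; first by [].
transitivity ((- a)%:E * nu A - (- a)%:E * mu A)%E; last by [].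
rewrite mE// EFinN !mulNe oppeK.
rewrite muleBr//; last by rewrite fin_num_adde_defr// fin_measure.
by rewrite addeC.
Qed.

Lemma pairing_dirac (tau : circle T) f : continuous f ->
  pairing (dirac_impulse tau) f = f tau.
Proof.
move=> fc; rewrite (@pairing_splits _ (dirac tau) mzero)//.
  rewrite /Rintegral integral_dirac//; last first.
    by apply/measurable_EFinP; exact: circle_measurable_fun.
  by rewrite diracT mul1e integral_measure_zero subr0.
by split=> [||A mA]; rewrite ?diracT /mzero/= ?ltry ?sube0.
Qed.

Lemma pairing_dirac_sum P (tau : 'I_P -> circle T) (beta : 'cV[R]_P) f :
  continuous f ->
  pairing (dirac_sum tau beta) f = \sum_(p < P) beta p 0 * f (tau p).
Proof.
move=> fc; rewrite /dirac_sum.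
apply: (big_ind2 (fun (m : radon T) x => pairing m f = x)).
- exact: pairing_zero.
- by move=> m x m' x' <- <-; exact: pairing_add.
- by move=> p _; rewrite pairing_scale// pairing_dirac.
Qed.

Lemma dirac_sumE P (tau : 'I_P -> circle T) (beta : 'cV[R]_P) A :
  dirac_sum tau beta A = (\sum_(p < P) (beta p 0)%:E * \d_(tau p) A)%E.
Proof.
rewrite /dirac_sum.
apply: (big_ind2 (fun (m : radon T) x => m A = x)) => //.
by move=> m x m' x' <- <-.
Qed.

Lemma sup_norm_le1 phi : continuous phi ->
  sup_norm phi <= 1 <-> forall t, `|phi t| <= 1.
Proof.
move=> phic; split=> [le1 t|le1].
  apply: le_trans le1; apply: ub_le_sup; last by exists t.
  have [M phiM] := continuous_circle_bounded phic.
  by exists M => _ [s _ <-].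
apply: ge_sup; first by exists `|phi 0|, 0.
by move=> _ [s _ <-].
Qed.

(** The supremum that defines the norm is taken over a bounded set, because
    pairings with the unit ball are at most the total mass of the Jordan parts. *)
Lemma pairing_le_TV m phi : continuous phi -> (forall t, `|phi t| <= 1) ->
  pairing m phi <= TV_norm m.
Proof.
move=> phic phi1; apply: ub_le_sup; last first.
  by exists phi => //; split=> //; exact/sup_norm_le1.
have [mu [nu [[muoo nuoo _] mE]]] := jordan_split m.
exists (fine (mu setT) + fine (nu setT)) => _ [f [fc /sup_norm_le1-/(_ fc) f1] <-].
have bound (l : {measure set (circle T) -> \bar R}) (g : circle T -> R) :
    (l setT < +oo)%E -> continuous g ->
    (forall t, g t <= 1) -> \int[l]_t g t <= fine (l setT).
  move=> loo gc g1; rewrite -[leRHS]mul1r -Rintegral_cst//.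
  apply: le_Rintegral => //; do ?exact: continuous_integrable.
  by apply: continuous_integrable => //; exact: continuous_const.
rewrite mE; apply: lerD.
  by apply: bound => // t; have := f1 t; rewrite ler_norml => /andP[].
rewrite -mulN1r -RintegralZl//; last exact: continuous_integrable.
apply: bound => // [|t]; first exact: continuous_scale.
by have := f1 t; rewrite ler_norml mulN1r lerNl => /andP[].
Qed.

Lemma TV_le m r : (forall phi, continuous phi -> (forall t, `|phi t| <= 1) ->
  pairing m phi <= r) -> TV_norm m <= r.
Proof.
move=> mr; apply: ge_sup.
  exists (pairing m (fun=> 0)), (fun=> 0) => //.
  have c0 : continuous (fun _ : circle T => 0 : R) by exact: continuous_const.
  by split=> //; apply/sup_norm_le1 => // t; rewrite normr0.
by move=> _ [f [fc /sup_norm_le1-/(_ fc) f1] <-]; exact: mr.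
Qed.

(** Monotone convergence: the integrands increase to the indicator of the
    positivity set. *)
Lemma positivity_set_measure_limit (mu : {measure set (circle T) -> \bar R})
    (u : circle T -> R) : continuous u -> (forall t, 0 <= u t) ->
  (\int[mu]_t (Num.min 1 (n%:R * u t))%:E)%E @[n --> \oo] -->
    mu [set t | 0 < u t].
Proof.
move=> uc u0.
pose g n t : \bar R := (Num.min 1 (n%:R * u t))%:E.
have gc n : continuous (fun t => Num.min 1 (n%:R * u t)).
  exact/continuous_min1/continuous_scale.
have mg n : measurable_fun setT (g n).
  by apply/measurable_EFinP; exact: circle_measurable_fun.
have g0 n t : [set: circle T] t -> (0 <= g n t)%E.
  by move=> _; rewrite lee_fin le_min ler01 mulr_ge0.
have ndg t : [set: circle T] t -> {homo g^~ t : n p / (n <= p)%N >-> (n <= p)%E}.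
  move=> _ n p np; rewrite lee_fin le_min ge_min lexx/=.
  by rewrite ge_min ler_wpM2r ?ler_nat ?orbT.
have := @cvg_monotone_convergence _ _ _ mu setT measurableT g mg g0 ndg.
suff -> : (\int[mu]_t limn (g^~ t) = mu [set t | (0 < u t)%R])%E by [].
have mu0 := circle_measurable_gt0 uc.
transitivity (\int[mu]_t (\1_[set t | 0 < u t] t)%:E)%E; last first.
  by rewrite integral_indic// setIT.
apply: eq_integral => t _; rewrite indicE; have [ut|ut] := ltP 0 (u t).
  rewrite mem_set//=; apply/cvg_lim => //.
  apply: (@cvg_near_cst _ _ _ _ _ _ _).
  near=> n; rewrite /g; congr EFin; apply/min_idPl.
  rewrite -ler_pdivrMr// mul1r ltW//.
  by near: n; exact: nbhs_infty_gtr.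
rewrite memNset/=; last by apply/negP; rewrite -leNgt.
have {}ut : u t = 0 by apply/eqP; rewrite eq_le ut u0.
apply/cvg_lim => //; rewrite (_ : g^~ t = cst 0%E); first exact: cvg_cst.
by apply/funext => n; rewrite /g ut mulr0 min_r.
Unshelve. all: by end_near. Qed.

Lemma set_seq_cons (X : eqType) (x : X) (s : seq X) :
  [set` x :: s] = [set x] `|` [set` s].
Proof.
apply/seteqP; split=> y /=; rewrite inE.
  by case/predU1P; [left|right].
by case=> [->|->]; rewrite ?eqxx ?orbT.
Qed.

Lemma charge_finite_set m (s : seq (circle T)) (A : set (circle T)) :
  uniq s -> measurable A ->
  m (A `&` [set` s]) = (\sum_(x <- s) (fine (m [set x]))%:E * \d_x A)%E.
Proof.
elim: s => [_ mA|x s IHs /=/andP[xs us] mA].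
  by rewrite big_nil set_nil setI0 charge0.
have ms : measurable [set` s].
  elim: s {IHs xs us} => [|y s ms]; first by rewrite set_nil; exact: measurable0.
  by rewrite set_seq_cons; apply: measurableU => //; exact: circle_measurable_set1.
have mx := circle_measurable_set1 T0 x.
rewrite big_cons set_seq_cons setIUr chargeU; [|exact: measurableI..|].
- rewrite IHs//; congr (_ + _)%E; rewrite diracE.
  have [xA|xA] := boolP (x \in A).
    rewrite mule1 (_ : A `&` [set x] = [set x]).
      by rewrite fineK// fin_num_measure.
    by rewrite setIidr// => y ->; exact/set_mem.
  rewrite mule0 (_ : A `&` [set x] = set0) ?charge0//.
  by apply/seteqP; split=> // y [Ay yx]; move: xA; rewrite -yx mem_set.
- apply/seteqP; split=> // y [[_ ->] [_ /=]].
  by rewrite (negbTE xs).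
Qed.

End pairing_calculus.

(** * Extremal measures *)

Section extremal_measures.
Context {R : realType} (T : R).
Hypothesis T0 : 0 < T.
Variables (m : radon T) (eta : circle T -> R).
Hypothesis etac : continuous eta.
Hypothesis eta1 : forall t, `|eta t| <= 1.
Hypothesis extremal : pairing m eta = TV_norm m.

(** The room left by [eta]: a perturbation bounded by [slack] keeps [eta] in the
    unit ball, and [slack] vanishes exactly on [Sat eta]. *)
Let slack t := 1 - `|eta t|.

Let slackc : continuous slack.
Proof.
by apply: continuous_sub; [exact: continuous_const|exact: continuous_norm].
Qed.

Let slack0 t : 0 <= slack t. Proof. by rewrite subr_ge0. Qed.

(** [eta] maximises the pairing with [m] over the unit ball, and both
    [eta + phi / C] and [eta - phi / C] lie in that ball. *)
Lemma pairing_slack_eq0 (phi : circle T -> R) (C : R) : 0 < C ->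
  continuous phi -> (forall t, `|phi t| <= C * slack t) -> pairing m phi = 0.
Proof.
move=> C0 phic phiC.
have le0 s : `|s| = 1 -> s * pairing m phi <= 0.
  move=> s1; have sc : continuous (fun t => s / C * phi t).
    exact: continuous_scale.
  have : pairing m (fun t => eta t + s / C * phi t) <= TV_norm m.
    apply: pairing_le_TV => // [|t]; first exact: continuous_add.
    rewrite (le_trans (ler_normD _ _))// -lerBrDl -/(slack t).
    by rewrite !normrM s1 mul1r normfV (gtr0_norm C0) mulrC ler_pdivrMr// mulrC.
  rewrite pairingD// pairingZ// extremal gerDl mulrAC.
  by rewrite (@pmulr_lle0 _ C^-1) ?invr_gt0.
apply/eqP; rewrite eq_le -{1}[pairing _ _]mul1r le0 ?normr1//=.
by rewrite -oppr_le0 -mulN1r le0// normrN1.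
Qed.

(** For an open set [U], the indicator of [U] cut down to the region of positive
    slack is the increasing limit of min(1, n * d * slack), where [d] is positive
    exactly on [U]; each of these functions is bounded by a multiple of [slack],
    hence pairs to 0 with [m]. Thus the two parts of [m] agree on these sets, and
    open sets generate the Borel sets. This replaces the identity between
    [TV_norm m] and the mass of the variation of [m], which would require
    approximating the sign of [m] by continuous functions. *)
Lemma extremal_null_off_saturation (A : set (circle T)) : measurable A ->
  m (A `&` [set t | 0 < slack t]) = 0%E.
Proof.
have [mu [nu [[muoo nuoo mE] mpair]]] := jordan_split m.
have mW := circle_measurable_gt0 slackc.
have on_open U : open U ->
    mu (U `&` [set t | 0 < slack t]) = nu (U `&` [set t | 0 < slack t]).
  move=> oU; have [d dc [d0 UE]] := open_positivity_set oU.
  have [M dM] := continuous_circle_bounded T0 dc.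
  pose u t := d t * slack t.
  have u0 t : 0 <= u t by rewrite mulr_ge0.
  have uc : continuous u by exact: continuous_mul.
  have -> : U `&` [set t | 0 < slack t] = [set t | 0 < u t].
    rewrite UE; apply/seteqP; split=> t /=; rewrite /u.
      by case=> dt st; exact: mulr_gt0.
    by rewrite !lt0r mulf_eq0 negb_or d0 slack0 => /andP[/andP[-> ->]].
  have nc n : continuous (fun t => Num.min 1 (n%:R * u t)).
    exact/continuous_min1/continuous_scale.
  have eq_int n : (\int[mu]_t (Num.min 1 (n%:R * u t))%:E =
      \int[nu]_t (Num.min 1 (n%:R * u t))%:E)%E.
    have /= imu :=
      integrable_fin_num measurableT (continuous_integrable T0 muoo (nc n)).
    have /= inu :=
      integrable_fin_num measurableT (continuous_integrable T0 nuoo (nc n)).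
    rewrite -(fineK imu) -(fineK inu); congr EFin.
    apply/eqP; rewrite -subr_eq0; apply/eqP; rewrite -[LHS]/(_ - _) -mpair.
    have M0 : 0 <= M by apply: le_trans (dM 0).
    (* The + 1 only makes the constant positive when n = 0. *)
    apply: (@pairing_slack_eq0 _ (n%:R * M + 1)) => // [|t].
      by rewrite ltr_wpDl// mulr_ge0.
    rewrite ger0_norm; last by rewrite le_min ler01 mulr_ge0.
    rewrite ge_min; apply/orP; right; rewrite /u mulrA ler_wpM2r//.
    rewrite (@le_trans _ _ (n%:R * M))// ?lerDl// ler_wpM2l//.
    exact: le_trans (ler_norm _) (dM t).
  have lmu := @positivity_set_measure_limit _ _ mu u uc u0.
  have lnu := @positivity_set_measure_limit _ _ nu u uc u0.
  by move: lmu; rewrite (funext eq_int) => /cvg_unique; apply.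
move=> mA; rewrite mE; last exact: measurableI.
suff -> : mu (A `&` [set t | 0 < slack t]) = nu (A `&` [set t | 0 < slack t]).
  by rewrite subee// ; apply: lty_fin_num_fun => //; exact: measurableI.
apply: (@g_sigma_algebra_measure_unique _ _ (circle T) (@open (circle T)) _
  (fun=> setT) _ _ (mrestr mu mW) (mrestr nu mW)) => //.
- by move=> U oU; exact: circle_measurable_open.
- by move=> _; exact: openT.
- by rewrite bigcup_const.
- exact: openI.
- move=> k; rewrite /mrestr (le_lt_trans _ muoo)//.
  by apply: le_measure; rewrite ?inE//; exact: measurableI.
Qed.

(** A measure that is null off [Sat eta] is determined by the masses of its points. *)
Lemma extremal_discrete (P : nat) (tau : 'I_P -> circle T) :
  injective tau -> Sat eta = range tau ->
  radon_eq m (dirac_sum tau (\col_p fine (m [set tau p]))).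
Proof.
move=> tauI SatE A mA; have mW := circle_measurable_gt0 slackc.
have WC : ~` [set t | 0 < slack t] = [set` codom tau].
  transitivity (Sat eta).
    apply/seteqP; split=> t /=; rewrite /slack subr_gt0.
      move=> /negP; rewrite -leNgt => et.
      have : `|eta t| = 1 by apply/eqP; rewrite eq_le eta1 et.
      have [e0|e0] := leP 0 (eta t); first by rewrite ger0_norm//; left.
      by rewrite ltr0_norm// => e1; right; rewrite -e1 opprK.
    by case=> ->; rewrite ?normrN normr1 ltxx.
  rewrite SatE; apply/seteqP; split=> t /=; first by case=> p _ <-; exact: codom_f.
  by case/codomP => p ->; exists p.
rewrite (charge_partition m mA mW (measurableC mW)) ?setUv ?setICr//.
rewrite extremal_null_off_saturation// add0e WC charge_finite_set//; last first.
  by rewrite map_inj_uniq ?enum_uniq.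
by rewrite dirac_sumE big_image/=; apply: eq_bigr => p _; rewrite mxE.
Qed.

End extremal_measures.

(** * The primal problem *)

Lemma continuous_reflection (R : realType) (T : R) (psi : circle T -> R)
    (a : circle T) :
  continuous psi -> continuous (fun t : circle T => psi (a - t)).
Proof.
move=> psic; apply: continuous_lift; have [y <-] := to_circle_surj a.
rewrite (_ : _ \o _ = psi \o (to_circle T \o (fun x => y - x))); last first.
  by apply/funext => x /=; rewrite to_circleB.
move=> x; apply: continuous_comp; last exact: psic.
apply: continuous_comp; last exact: to_circle_continuous.
by apply: cvgB; [exact: cvg_cst|exact: cvg_id].
Qed.

Lemma mulmx_injective_rank (R : fieldType) (L P : nat) (A : 'M[R]_(L, P)) :
  injective (fun beta : 'cV[R]_P => A *m beta) <-> \rank A = P.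
Proof.
rewrite -mxrank_tr; split=> [Ainj|rkA].
  apply/eqP; rewrite -[_ == _]/(row_free A^T) -kermx_eq0.
  apply/negPn/negP => /rowV0Pn[d /sub_kermxP dA /eqP]; apply.
  apply: (can_inj (@trmxK _ _ _)); apply: Ainj.
  by rewrite -[A]trmxK -!trmx_mul dA mul0mx.
have fA : row_free A^T by rewrite /row_free rkA.
move=> b c /(congr1 trmx); rewrite !trmx_mul => /(row_free_inj fA).
exact: (can_inj (@trmxK _ _ _)).
Qed.

Section primal_problem.
Context {R : realType} (T : R) (psi : circle T -> R) (L : nat).
Variables (theta : 'I_L -> circle T) (y0 : 'cV[R]_L).
Hypothesis T0 : 0 < T.
Hypothesis psic : continuous psi.

Lemma measurement_dirac_sum P (tau : 'I_P -> circle T) (beta : 'cV[R]_P) :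
  measurement psi theta (dirac_sum tau beta) =
  sampling_matrix psi theta tau *m beta.
Proof.
apply/colP => l; rewrite !mxE pairing_dirac_sum//.
  by apply: eq_bigr => p _; rewrite !mxE mulrC.
exact: continuous_reflection.
Qed.

Lemma measurement_eq m m' :
  radon_eq m m' -> measurement psi theta m = measurement psi theta m'.
Proof.
move=> mm'; apply/colP => l; rewrite !mxE; apply: pairing_eq => //.
exact: continuous_reflection.
Qed.

(** Every feasible [m] is matched by a feasible combination of [L] atoms whose
    mass is at most [TV_norm m], and the norm of such a combination is at most
    its mass. So the feasible combination of [L] atoms with the least mass, which
    exists by compactness, is a solution. *)
Lemma primal_solution_exists m0 : y0 = measurement psi theta m0 ->
  exists m, primal_solution psi theta y0 m.
Proof.
move=> y0E; pose v l t := psi (theta l - t); pose y l := y0 l 0.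
have vc l : continuous (v l) by exact: continuous_reflection.
have atomic m : measurement psi theta m = y0 ->
    exists2 f, mass f <= TV_norm m & misfit v y f = 0.
  move=> my.
  apply: (@atoms_of_functional _ _ _ v y (circle_compact T0) vc (pairing m)).
  - by move=> f g; exact: pairingD.
  - by move=> a f; exact: pairingZ.
  - by move=> f; exact: pairing_le_TV.
  - by move=> l; rewrite /y -my mxE.
have [f0 _ f00] := atomic m0 (esym y0E).
have [f fy fmin] := minimal_atoms (circle_compact T0) vc f00.
exists (dirac_sum (fun i => (f i).2) (\col_i (f i).1)); split.
  apply/colP => l; rewrite mxE pairing_dirac_sum//; last exact: vc.
  have := misfit_eq0 fy l; rewrite /y => ->.
  by apply: eq_bigr => i _; rewrite mxE.
move=> m /atomic[g gm gy]; apply: le_trans gm; apply: le_trans (fmin g gy).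
apply: TV_le => // phi phic phi1; rewrite pairing_dirac_sum//.
apply: ler_sum => i _; rewrite mxE (le_trans (ler_norm _))// normrM.
by rewrite ler_piMr.
Qed.

Lemma primal_solution_discrete eta P (tau : 'I_P -> circle T) m :
    dual_certificate psi theta y0 eta -> injective tau -> Sat eta = range tau ->
    primal_solution psi theta y0 m ->
  radon_eq m (dirac_sum tau (\col_p fine (m [set tau p]))).
Proof.
move=> [etac _ /sup_norm_le1-/(_ T0 etac) eta1 etam] tauI SatE /etam meta.
exact: extremal_discrete SatE.
Qed.

End primal_problem.

Theorem mainTheorem3 (R : realType) (T : R) (hT : 0 < T)
    (D Dinv : distr T -> distr T) (hD : LSI D)
    (hDK : cancel D Dinv) (hKD : cancel Dinv D)
    (psi : circle T -> R) (hpsi : continuous psi) (hgreen : is_green Dinv psi)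
    (L : nat) (theta : 'I_L -> circle T)
    (m0 : radon T) (y0 : 'cV[R]_L) (hy0 : y0 = measurement psi theta m0)
    (eta : circle T -> R) (heta : dual_certificate psi theta y0 eta)
    (P : nat) (tau : 'I_P -> circle T) (htau : injective tau)
    (hSat : Sat eta = range tau) :
  let F (beta : 'cV[R]_P) : 'cV[R]_L :=
    measurement psi theta (dirac_sum tau beta) in
  [/\ forall beta, F beta = \col_l \sum_(p < P) beta p 0 * psi (theta l - tau p),
      injective F ->
        exists m, primal_solution psi theta y0 m /\
          forall m', primal_solution psi theta y0 m' -> radon_eq m' m
    & injective F <-> \rank (sampling_matrix psi theta tau) = P].
Proof.
move=> F; have FE : F = fun beta => sampling_matrix psi theta tau *m beta.
  by apply/funext => beta; exact: measurement_dirac_sum.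
split.
- move=> beta; rewrite FE; apply/colP => l; rewrite !mxE.
  by apply: eq_bigr => p _; rewrite !mxE mulrC.
- move=> Finj; have [m mP] := primal_solution_exists hT hpsi hy0.
  exists m; split=> // m' m'P A mA.
  have mE := primal_solution_discrete hT heta htau hSat mP.
  have m'E := primal_solution_discrete hT heta htau hSat m'P.
  rewrite mE// m'E//; congr (dirac_sum tau _ A); apply: Finj.
  rewrite /F -(measurement_eq theta hT hpsi mE) -(measurement_eq theta hT hpsi m'E).
  by case: mP => -> _; case: m'P => ->.
- by rewrite FE; exact: mulmx_injective_rank.
Qed.
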